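(* For all integers $n\ge k\ge 0$, the entries $t_{n,k}(q)$ of the $q$-trees matrix satisfy $$t_{n,k}(q)=\sum_{F\in\mathcal{F}^*_{n+1,k+1}}q^{\operatorname{niblings}(F)+\operatorname{scindex}(F)+\operatorname{parents}(F)-|V_t(F)|}=\binom{n}{k}_q([n]_q)^{n-k},$$ where $\mathcal{F}^*_{n+1,k+1}$ denotes the set of forests of rooted labelled trees on the vertex set $[n+1]=\{1,\dots,n+1\}$ with $k+1$ components in which the vertex $n+1$ is a leaf. (Here $|V_t(F)|=n-k-1$ if $n>k$, and $|V_t(F)|=0$ if $n=k$.)
   Context: $[n]_q=1+q+\cdots+q^{n-1}$ for $n>0$, $[0]_q=0$, and $\binom{n}{k}_q$ is the $q$-binomial coefficient. The $q$-trees numbers are $t_{n,k}(q)=\binom{n}{k}_q([n]_q)^{n-k}$ (with $t_{0,0}(q)=1$). A leaf is a vertex with no children; in particular a root with no children is a leaf. Let $F$ be a forest of rooted labelled trees on $[N]$ with $K$ components. Let $V_r(F)$ be the set of roots of components of $F$. If $F$ has a non-root vertex (i.e. $N>K$), let $v_{\min}$ be the lowest-numbered vertex among all children of roots, and let $V_s(F)=\{v_{\min}\}$; if $N=K$, let $V_s(F)=\emptyset$. Let $V_t(F)$ be the set of all remaining vertices. Define: - for each $v\in V_r(F)$, $V_r(F,v)=\{v' : v'\notin V_r(F),\ v'<v\}$, and $\operatorname{niblings}(F)=\sum_{v\in V_r(F)}|V_r(F,v)|$; - writing the roots as $v_0<v_1<\cdots<v_{K-1}$, $\operatorname{scindex}(F)=j$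 where $v_j$ is the parent of $v_{\min}$ (and $\operatorname{scindex}(F)=0$ if $N=K$); - $\operatorname{parents}(F)=\sum_{v\in V_t(F)}\operatorname{parent}(v)$, where $\operatorname{parent}(v)$ is the label of the parent of $v$. *)

(* Defs.v *)
From mathcomp Require Import all_boot all_order all_algebra.

Set Implicit Arguments.
Unset Strict Implicit.
Unset Printing Implicit Defensive.

Import GRing.Theory.
Local Open Scope ring_scope.

(* The indeterminate q is 'X in {poly rat}. *)

Definition qnat (n : nat) : {poly rat} := \sum_(i < n) 'X^i.

Definition qfact (n : nat) : {poly rat} := \prod_(i < n) qnat i.+1.

(* The division is exact: see qbinom_fact below. *)
Definition qbinom (n k : nat) : {poly rat} :=
  if (k <= n)%N then qfact n %/ (qfact k * qfact (n - k)) else 0.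

(* Since x ^+ 0 = 1, this gives qtree 0 0 = 1. *)
Definition qtree (n k : nat) : {poly rat} := qbinom n k * qnat n ^+ (n - k).

Lemma qfactS n : qfact n.+1 = qfact n * qnat n.+1.
Proof. by rewrite /qfact big_ord_recr. Qed.

Lemma qnatD a b : qnat (a + b) = qnat a + 'X^a * qnat b.
Proof.
rewrite /qnat big_split_ord /=; congr (_ + _).
by rewrite mulr_sumr; apply: eq_bigr => i _; rewrite exprD.
Qed.

Lemma dvdp_qfact a b : qfact a * qfact b %| qfact (a + b).
Proof.
have [m] := ubnP (a + b); elim: m a b => // m IHm [|a] [|b] ltm;
  rewrite ?addn0 ?add0n.
- by rewrite /qfact big_ord0 mulr1.
- by rewrite {1}/qfact big_ord0 mul1r.
- by rewrite {2}/qfact big_ord0 mulr1.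
have -> : (a.+1 + b.+1 = (a + b.+1).+1)%N by rewrite addSn.
have -> : qfact (a + b.+1).+1 =
    qfact (a + b.+1) * qnat a.+1 + qfact (a.+1 + b) * ('X^(a.+1) * qnat b.+1).
  by rewrite qfactS -addSn qnatD mulrDr -addSnnS.
have ltm' : (a + b.+1 < m)%N by rewrite -ltnS -addSn.
apply: dvdp_add.
  by rewrite (qfactS a) mulrAC dvdp_mul // IHm.
by rewrite (qfactS b) !mulrA dvdp_mul // dvdp_mulr // IHm // addSnnS.
Qed.

Lemma qbinom_fact n k :
  (k <= n)%N -> qbinom n k * (qfact k * qfact (n - k)) = qfact n.
Proof.
by move=> lekn; rewrite /qbinom lekn divpK // -{2}(subnKC lekn) dvdp_qfact.
Qed.

Section Forests.

Variable N : nat.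

(* The vertex with label m in {1, ..., N} is the ordinal i with m = i.+1. *)
Definition label (v : 'I_N) : nat := v.+1.

(* A rooted forest is given by its parent map: F v = Some u when u is the     *)
(* parent of v, and F v = None when v is a root.                              *)
Definition parent_map : finType := {ffun 'I_N -> option 'I_N}.

Implicit Type F : parent_map.

Definition parent_rel F : rel 'I_N := fun v u => F v == Some u.

(* No vertex is a proper ancestor of itself. *)
Definition is_forest F : bool :=
  [forall v, forall u, parent_rel F v u ==> ~~ connect (parent_rel F) u v].

Definition adjacent F : rel 'I_N :=
  fun u v => parent_rel F u v || parent_rel F v u.

Definition ncomponents F : nat := n_comp (adjacent F) 'I_N.

Definition is_leaf F (v : 'I_N) : bool := [forall u, ~~ parent_rel F u v].

Definition Vr F : {set 'I_N} := [set v | F v == None].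

Definition root_children F : {set 'I_N} :=
  [set v | [exists u in Vr F, parent_rel F v u]].

(* In a forest this is None exactly when there is no non-root vertex. *)
Definition vmin F : option 'I_N :=
  [pick v in root_children F |
     [forall w in root_children F, label v <= label w]%N].

Definition Vs F : {set 'I_N} := if vmin F is Some v then [set v] else set0.

Definition Vt F : {set 'I_N} := ~: (Vr F :|: Vs F).

Definition Vr_below F (v : 'I_N) : {set 'I_N} :=
  [set v' | (v' \notin Vr F) && (label v' < label v)%N].

Definition niblings F : nat := (\sum_(v in Vr F) #|Vr_below F v|)%N.

(* enum lists a set of ordinals in increasing order, so the position of v_j   *)
(* in enum (Vr F) is j.                                                       *)
Definition scindex F : nat :=
  if vmin F is Some v then
    if F v is Some r then index r (enum (Vr F)) else 0%N
  else 0%N.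

(* The value in the None branch is irrelevant: Vt F contains no root. *)
Definition parent_label F (v : 'I_N) : nat :=
  if F v is Some u then label u else 0%N.

Definition parents F : nat := (\sum_(v in Vt F) parent_label F v)%N.

(* The subtraction does not truncate: every vertex of Vt F has a parent, and  *)
(* labels are at least 1.                                                     *)
Definition forest_weight F : nat :=
  (niblings F + scindex F + parents F - #|Vt F|)%N.

End Forests.

Definition leaf_forests (n k : nat) : {set parent_map n.+1} :=
  [set F | [&& is_forest F, ncomponents F == k.+1 & is_leaf F ord_max]].

(* Main.v *)
Require Import Defs.
From mathcomp Require Import all_boot all_order all_algebra.
From mathcomp Require Import ring zify.

Set Implicit Arguments.
Unset Strict Implicit.
Unset Printing Implicit Defensive.

Import GRing.Theory.
Local Open Scope ring_scope.

(** Fix the root set [R] of a forest. The statistic [niblings] depends on [R]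
    alone, and the rest of the weight is a product over the non-root vertices
    [v] of a factor depending only on the parent of [v]: a parent [u] counts
    q^u (its label minus one) when [v] is in [Vt], and a parent [r] counts q^j,
    with [j] the position of [r] among the roots, when [v] is [vmin]. Giving the
    last vertex [ord_max] the factor 0 as a parent forces it to be a leaf.

    When there is a non-root, these forests are counted by a multivariate Cayley
    formula ([sum_rooted_forests]): with arbitrary factors [x u] for all parents
    but that of [vmin], and [y r] for the parent of [vmin], the forests with
    root set [R] and set [S] of non-roots sum to
      (sum of y over R) * (sum of x over R and S)^(|S| - 1).
    The reason that [vmin] can be treated apart is that, once the set [C] of
    children of the roots is known, the parents of the vertices of [C] are
    chosen in [R] independently of each other and of the forest below, which is
    a forest with root set [C] ([sum_by_children]). The marked element of [C]
    then yields a factor (sum of y), each other one a factor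
    a = (sum of x over R), and by induction on [S] there remains to sum
      a^(|C| - 1) * (sum of x over C) * b^(|S| - |C| - 1)
    over the nonempty [C], where [b] is the sum of [x] over [S] and the term
    C = S is to be read as a^(|S| - 1). By symmetry among the elements of [S]
    this is a binomial expansion of (a + b)^(|S| - 1) ([sum_proper_subset]).

    Here the sum of [x] is [qnat n], and the sum of [y] is [qnat k] or
    [qnat k.+1] according to whether [ord_max] is a root or not. It remains to
    sum q^niblings times the sum of [y] over the sets [R] with [k.+1] elements.
    As [niblings] counts the inversions between roots and non-roots, its
    generating function over the subsets of a given size is a q-binomial
    coefficient ([sum_inversions]), and splitting according to whether
    [ord_max] is a root gives
      qbinom n k.+1 * qnat k.+1 + q^(n-k) * qbinom n k * qnat k,
    which equals [qbinom n k * qnat n]. When n = k there is only the forest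
    without edges, of weight 0. *)

(** * Acyclic parent maps *)

Section Structure.

Variable N : nat.
Implicit Types (F : parent_map N) (R S C : {set 'I_N}).

(** Acyclicity is easiest to transport between forests in the form of a rank
    increasing from parent to child: restricting a parent map keeps the same
    rank, and adding a layer of roots shifts it. The number of ancestors is such
    a rank. *)
Lemma is_forestP F :
  reflect (exists h : 'I_N -> nat, forall v u, F v = Some u -> (h u < h v)%N)
          (is_forest F).
Proof.
apply: (iffP forallP) => [Facyc | [h Fh] v].
  exists (fun v => #|[set u | connect (parent_rel F) v u]|) => v u Fvu.
  have e_vu : parent_rel F v u by rewrite /parent_rel Fvu.
  apply/proper_card/properP; split.
    by apply/subsetP => w; rewrite !inE; apply: connect_trans (connect1 e_vu).
  exists v; first by rewrite inE connect0.
  by rewrite inE; have /forallP/(_ u)/implyP/(_ e_vu) := Facyc v.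
apply/forallP => u; apply/implyP => /eqP/Fh lt_uv.
apply/negP => /connectP[p pth ev]; move: lt_uv; rewrite {}ev ltnNge.
case/negP; elim: p u pth => //= w p IHp u /andP[/eqP/Fh lt_wu /IHp].
by move/leq_trans; apply; apply: ltnW.
Qed.

(** Climbing from a vertex for as many steps as the largest rank ends at a root,
    and this root is an invariant of adjacency; hence each component contains
    exactly one root. *)
Lemma ncomponentsE F : is_forest F -> ncomponents F = #|Vr F|.
Proof.
case/is_forestP=> h Fh; pose up v := odflt v (F v).
pose d := (\max_v h v)%N; pose top v := iter d up v.
have iter_root m v : (h v <= m)%N -> F (iter m up v) = None.
  elim: m v => [|m IHm] v.
    rewrite leqn0 => /eqP hv; case Fv: (F v) => [u|//].
    by have := Fh _ _ Fv; rewrite hv.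
  rewrite iterSr {2}/up; case Fv: (F v) => [u|] /= hv.
    by apply: IHm; rewrite -ltnS (leq_trans (Fh _ _ Fv)).
  have fix_v i : iter i up v = v by elim: i => //= i ->; rewrite /up Fv.
  by rewrite fix_v.
have top_root v : F (top v) = None by apply/iter_root/leq_bigmax.
have top_up v : top (up v) = top v.
  by rewrite /top -iterSr iterS -/(top v) {1}/up top_root.
have top_id v : F v = None -> top v = v.
  move=> Fv; rewrite /top; elim: (d) => //= m ->; by rewrite /up Fv.
have adj_sym : connect_sym (adjacent F).
  by apply: sym_connect_sym => u v; rewrite /adjacent orbC.
have conn_up v : connect (adjacent F) v (up v).
  rewrite /up; case Fv: (F v) => [u|] /=; last exact: connect0.
  by apply: connect1; rewrite /adjacent /parent_rel Fv eqxx.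
have conn_top v : connect (adjacent F) v (top v).
  rewrite /top; elim: (d) => [|m IHm]; first exact: connect0.
  by rewrite iterS; apply: connect_trans IHm (conn_up _).
have top_inv u v : connect (adjacent F) u v -> top u = top v.
  have step w t : adjacent F w t -> top w = top t.
    case/orP=> /eqP e; last by rewrite -(top_up t) /up e.
    by rewrite -(top_up w) /up e.
  case/connectP=> p pth ->; elim: p u pth => //= w p IHp u /andP[/step -> ].
  exact: IHp.
rewrite /ncomponents /n_comp_mem.
have -> : #|Vr F| = #|[set fingraph.root (adjacent F) v | v in Vr F]|.
  rewrite card_in_imset // => u v; rewrite !inE => /eqP Fu /eqP Fv.
  by move/eqP; rewrite root_connect // => /top_inv; rewrite !top_id.
apply: eq_card => v; rewrite !inE andbT.
apply/idP/imsetP=> [/eqP rv | [u _ ->]].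
  exists (top v); first by rewrite inE top_root.
  by rewrite -{1}rv; apply/eqP; rewrite root_connect.
exact: roots_root.
Qed.

(** The vertices outside [R :|: S] are kept, as isolated roots: removing the
    roots of a forest thus leaves an object of the same kind, on the same vertex
    type. *)
Definition rooted_forests S R : {set parent_map N} :=
  [set F | is_forest F &
     F \in pfamily None (mem S) (fun _ => mem (Some @: (R :|: S)))].

Definition children R F : {set 'I_N} := [set v | F v \in Some @: R].

Lemma mem_some_imset (R : {set 'I_N}) u : (Some u \in Some @: R) = (u \in R).
Proof. by rewrite mem_imset //; apply: Some_inj. Qed.

Lemma none_imset (R : {set 'I_N}) : (None \in Some @: R) = false.
Proof. by apply/imsetP => -[]. Qed.

Lemma rooted_forestsP S R F :
  reflect (is_forest F /\
     forall v, if v \in S then exists2 u, F v = Some u & u \in R :|: S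
               else F v = None)
    (F \in rooted_forests S R).
Proof.
rewrite inE; apply: (iffP andP) => -[Ff H]; split=> //.
  case/pfamilyP: H => sF FS v; case: ifPn => [/FS/imsetP[u ? ->]|vS].
    by exists u.
  by apply: contraNeq vS => Fv; apply: (subsetP sF); rewrite inE.
apply/pfamilyP; split=> [|v vS].
  apply/subsetP => v; rewrite inE; apply: contraR => vS.
  by have:= H v; rewrite (negPf vS) => ->.
by have:= H v; rewrite ifT // => -[u -> uRS]; rewrite mem_some_imset.
Qed.

Lemma children_sub S R F : F \in rooted_forests S R -> children R F \subset S.
Proof.
case/rooted_forestsP=> _ H; apply/subsetP => v; rewrite inE.
by have:= H v; case: ifP => // _ ->; rewrite none_imset.
Qed.

(** The parent of a vertex of least rank in [S] is not in [S]. *)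
Lemma children_neq0 S R F :
  S != set0 -> F \in rooted_forests S R -> children R F != set0.
Proof.
case/set0Pn=> v0 v0S /rooted_forestsP[/is_forestP[h Fh] H].
case: (arg_minnP h v0S) => v vS minv; apply/set0Pn; exists v.
have:= H v; rewrite ifT // => -[u Fv]; rewrite in_setU inE Fv mem_some_imset.
case/orP=> // /minv; by rewrite leqNgt Fh.
Qed.

(** A forest whose roots have [C] as set of children amounts to a choice in [R]
    of a parent for each vertex of [C], together with a forest with root set
    [C]. The weight [z v u] of the edge from [v] to its parent [u] may depend on
    [v], which leaves room for a distinguished vertex of [C]. *)
Lemma sum_by_children (A : comNzRingType) (z : 'I_N -> 'I_N -> A) S R C :
    [disjoint R & S] -> C \subset S ->
  \sum_(F in rooted_forests S R | children R F == C)
      \prod_(v in S) oapp (z v) 1 (F v) =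
    (\prod_(v in C) \sum_(u in R) z v u) *
    \sum_(F in rooted_forests (S :\: C) C)
      \prod_(v in S :\: C) oapp (z v) 1 (F v).
Proof.
move=> dRS sCS.
have -> : \prod_(v in C) \sum_(u in R) z v u =
    \sum_(g in pfamily None (mem C) (fun _ => mem (Some @: R)))
       \prod_(v in C) oapp (z v) 1 (g v).
  rewrite -(big_distr_big_dep None (mem C) (fun _ => mem (Some @: R))
    (fun v o => oapp (z v) 1 o)) /=.
  by apply: eq_bigr => v _; rewrite big_imset //= => u w _ _ [].
rewrite big_distrlr pair_big /=.
pose glue (p : parent_map N * parent_map N) : parent_map N :=
  [ffun v => if v \in C then p.1 v else p.2 v].
pose cut F : parent_map N * parent_map N :=
  ([ffun v => if v \in C then F v else None],
   [ffun v => if v \in C then None else F v]).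
rewrite (reindex_onto glue cut) /=; last first.
  by move=> F _; apply/ffunP => v; rewrite !ffunE; case: (v \in C).
apply: eq_big => [[g F'] | [g F'] _].
  rewrite /=; apply/idP/idP.
    case/andP=> /andP[GF /eqP chC] /eqP[eg eF].
    have [/is_forestP[h hG] HG] := rooted_forestsP _ _ _ GF.
    have gE v : g v = if v \in C then glue (g, F') v else None.
      by rewrite -{1}eg ffunE.
    have F'E v : F' v = if v \in C then None else glue (g, F') v.
      by rewrite -{1}eF ffunE.
    apply/andP; split.
      apply/pfamilyP; split=> [|v vC].
        apply/subsetP => v; rewrite inE; apply: contraR => vC.
        by rewrite gE (negPf vC).
      by rewrite gE vC; move: vC; rewrite -{1}chC inE.
    apply/rooted_forestsP; split.
      apply/is_forestP; exists h => v u; rewrite F'E; case: ifP => // _.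
      exact: hG.
    move=> v; rewrite F'E in_setD; case vC: (v \in C) => //=.
    have:= HG v; case: ifPn => // vS [u Gv uRS]; exists u => //.
    move/negbT: vC; rewrite -{1}chC inE Gv mem_some_imset.
    move: uRS; rewrite !inE => /orP[->//|uS _].
    by rewrite uS andbT orbN.
  case/andP=> /pfamilyP[sg gC] /rooted_forestsP[/is_forestP[h hF] HF].
  have gN v : v \notin C -> g v = None.
    by apply: contraNeq => gv; apply: (subsetP sg); rewrite inE.
  have FN v : v \in C -> F' v = None.
    by move=> vC; have:= HF v; rewrite in_setD vC.
  apply/andP; split; last first.
    apply/eqP; congr pair; apply/ffunP => v; rewrite !ffunE /=.
      by case vC: (v \in C); rewrite // gN ?vC.
    by case vC: (v \in C); rewrite // FN ?vC.
  apply/andP; split.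
    apply/rooted_forestsP; split.
      (* The roots take rank 0, below everything else. *)
      apply/is_forestP; exists (fun v => if v \in S then (h v).+1 else 0%N).
      move=> v u; rewrite ffunE /=; case: ifPn => [vC gv | vC Fv].
        have := gC _ vC; rewrite gv mem_some_imset => uR.
        by rewrite (subsetP sCS _ vC) (disjointFr dRS uR).
      have := HF v; rewrite in_setD vC /=; case: ifPn => [_ _|_].
        by case: ifP => // _; rewrite ltnS; apply: hF.
      by rewrite Fv.
    move=> v; rewrite ffunE /=; case vC: (v \in C).
      rewrite (subsetP sCS _ vC).
      by have /imsetP[u uR ->] := gC _ vC; exists u; rewrite // inE uR.
    have:= HF v; rewrite in_setD vC /=; case: ifP => // _ [u -> uCS].
    exists u => //; move: uCS; rewrite !inE.
    by case/orP=> [/(subsetP sCS)|/andP[_]] ->; rewrite orbT.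
  apply/eqP/setP => v; rewrite inE ffunE /=; case vC: (v \in C).
    exact: gC.
  have:= HF v; rewrite in_setD vC /=; case: ifP => [vS|_ ->]; last first.
    by rewrite none_imset.
  case=> u -> uCS; rewrite mem_some_imset; apply/negP => uR.
  move: uCS; rewrite !inE (disjointFr dRS uR) andbF orbF.
  by move/(subsetP sCS); rewrite (disjointFr dRS uR).
rewrite (big_setID C) /= (setIidPr sCS); congr (_ * _).
  by apply: eq_bigr => v vC; rewrite ffunE vC.
by apply: eq_bigr => v /setDP[_ vC]; rewrite ffunE (negPf vC).
Qed.

End Structure.

(** * The weighted Cayley formula *)

Lemma sum_subset_card (A : comNzRingType) (T : finType) (E : {set T})
    (g : nat -> A) :
  \sum_(D : {set T} | D \subset E) g #|D| =
    \sum_(j < #|E|.+1) g j *+ 'C(#|E|, j).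
Proof.
rewrite (partition_big (fun D : {set T} => inord #|D| : 'I_#|E|.+1) predT) //=.
apply: eq_bigr => j _; rewrite -cards_draws -sumr_const.
apply: eq_big => [D | D /andP[sDE /eqP<-]]; last first.
  by rewrite inordK // ltnS subset_leq_card.
rewrite inE; apply: andb_id2l => sDE.
by rewrite -val_eqE /= inordK // ltnS subset_leq_card.
Qed.

(** Expanding the sum of [x] over [C] and exchanging the sums, each [s] in [S]
    contributes [x s] times a sum over the proper subsets containing [s], which
    does not depend on [s]; the [x s] thus recombine into one more factor [b],
    and the result is the binomial expansion without its last term. *)
Lemma sum_proper_subset (A : comNzRingType) (T : finType) (S : {set T})
    (x : T -> A) (a : A) :
    S != set0 ->
  let b := \sum_(u in S) x u in
  \sum_(C : {set T} | C \proper S)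
     a ^+ #|C|.-1 * ((\sum_(u in C) x u) * b ^+ (#|S| - #|C|).-1) +
    a ^+ #|S|.-1 = (a + b) ^+ #|S|.-1.
Proof.
move=> S0 b; set m := #|S|.
have m_gt0 : (0 < m)%N by rewrite card_gt0.
(* The cut-off leaves out [j = m.-1], that is [C = S]. *)
pose g j := if (j < m.-1)%N then a ^+ j * b ^+ (m - j.+1).-1 else 0.
have sum_s s : s \in S ->
    \sum_(C : {set T} | (C \proper S) && (s \in C))
      a ^+ #|C|.-1 * b ^+ (m - #|C|).-1 =
    \sum_(j < m.-1.+1) g j *+ 'C(m.-1, j).
  move=> sS; pose E := S :\ s.
  have cE : #|E| = m.-1 by rewrite /m (cardsD1 s S) sS.
  rewrite -cE -sum_subset_card.
  rewrite [RHS](bigID (fun D : {set T} => (#|D| < m.-1)%N)) /=.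
  rewrite [X in _ = _ + X]big1 ?addr0; last first.
    by move=> D /andP[_ /negPf]; rewrite /g => ->.
  rewrite (reindex_onto (fun D => s |: D) (fun C => C :\ s)) /=; last first.
    by move=> C /andP[_ sC]; rewrite setD1K.
  apply: eq_big => [D | D].
    rewrite setU11 andbT; apply/andP/andP.
      case=> pDS /eqP eD; have sD : s \notin D by rewrite -eD !inE eqxx.
      have sDE : D \subset E.
        rewrite subsetD1 sD andbT.
        by rewrite (subset_trans _ (proper_sub pDS)) ?subsetUr.
      split=> //; move: (proper_card pDS); rewrite cardsU1 sD -/m; lia.
    case=> sDE ltD; have [sDS sD] : D \subset S /\ s \notin D.
      by apply/andP; rewrite -subsetD1.
    split; last by rewrite setU1K.
    rewrite properEcard subUset sub1set sS sDS cardsU1 sD -/m; lia.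
  case/andP=> /andP[pDS _] /eqP eD.
  have sD : s \notin D by rewrite -eD !inE eqxx.
  rewrite /g; move: (proper_card pDS); rewrite cardsU1 sD -/m /= add1n => ltm.
  by rewrite ifT //; lia.
under eq_bigr => C _ do rewrite mulrCA mulr_suml.
rewrite (exchange_big_dep (mem S)) /=; last first.
  by move=> C u /proper_sub/subsetP; apply.
under eq_bigr => u uS do rewrite -mulr_sumr sum_s //.
rewrite -mulr_suml -/b big_ord_recr /= {2}/g ltnn mul0rn addr0.
rewrite (addrC a) exprDn.
rewrite big_ord_recr /= subnn mul1r binn mulr1n mulr_sumr; congr (_ + _).
apply: eq_bigr => j _; rewrite /g ltn_ord mulrnAr; congr (_ *+ _).
rewrite mulrCA mulrC -exprS; congr (b ^+ _ * _).
by have := ltn_ord j; lia.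
Qed.

Lemma rooted_forests0 N (R : {set 'I_N}) :
  rooted_forests set0 R = [set [ffun=> None]].
Proof.
apply/setP => F; rewrite in_set1; apply/rooted_forestsP/eqP => [[_ H] | ->].
  by apply/ffunP => v; have := H v; rewrite inE ffunE.
split=> [|v]; last by rewrite inE ffunE.
by apply/is_forestP; exists (fun=> 0%N) => v u; rewrite ffunE.
Qed.

(** The mark [s] anticipates the choice of [vmin] among the children of the
    roots. Taking [y = x] erases it, and this is how the induction hypothesis
    applies to the forest below the children. *)
Lemma sum_rooted_forests (A : comNzRingType) N (s : {set 'I_N} -> 'I_N)
    (sP : forall C, C != set0 -> s C \in C) (x y : 'I_N -> A)
    (S R : {set 'I_N}) :
    S != set0 -> [disjoint R & S] ->
  \sum_(F in rooted_forests S R)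
     \prod_(v in S) oapp (if v == s (children R F) then y else x) 1 (F v) =
  (\sum_(u in R) y u) * (\sum_(u in R :|: S) x u) ^+ #|S|.-1.
Proof.
have [m] := ubnP #|S|; elim: m S R y => // m IHm S R y ltSm S0 dRS.
rewrite (partition_big (children R) (fun C => (C \subset S) && (C != set0))) /=;
  last by move=> F FSR; rewrite (children_sub FSR) (children_neq0 S0 FSR).
set Y := \sum_(u in R) y u; set a := \sum_(u in R) x u.
set b := \sum_(u in S) x u.
have term (C : {set 'I_N}) : (C \subset S) && (C != set0) ->
  \sum_(F in rooted_forests S R | children R F == C)
     \prod_(v in S) oapp (if v == s (children R F) then y else x) 1 (F v) =
  Y * (a ^+ #|C|.-1 *
    (if C == S then 1 else (\sum_(u in C) x u) * b ^+ (#|S| - #|C|).-1)).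
  case/andP=> sCS C0.
  under eq_bigr => F /andP[_ /eqP ->] do [].
  rewrite (sum_by_children (fun v => if v == s C then y else x)) // mulrA.
  have sC := sP _ C0.
  congr (_ * _).
    rewrite (bigD1 (s C)) //= eqxx; congr (_ * _).
    rewrite (eq_bigr (fun=> a)) => [|v /andP[_ /negPf->] //].
    rewrite prodr_const; congr (_ ^+ _).
    rewrite [#|C|](cardD1 (s C)) sC /=.
    by apply: eq_card => v; rewrite !inE andbC.
  have noC v : v \in S :\: C -> (v == s C) = false.
    by case/setDP=> _; apply: contraNF => /eqP->.
  (* For [C = S] nothing lies below [C]: only the edgeless forest remains. *)
  case: eqVneq => [-> | neCS].
    by rewrite setDv rooted_forests0 big_set1 big_set0.
  have D0 : S :\: C != set0.
    by rewrite setD_eq0; apply: contra neCS => sSC; rewrite eqEsubset sCS.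
  have ltD : (#|S :\: C| < m)%N.
    rewrite -ltnS (leq_trans _ ltSm) // ltnS cardsD (setIidPr sCS).
    by rewrite ltn_subrL !card_gt0 C0 S0.
  have dC : [disjoint C & S :\: C].
    by rewrite -setI_eq0 setIDA setIC -setIDA setDv setI0.
  transitivity ((\sum_(u in C) x u) *
     (\sum_(u in C :|: S :\: C) x u) ^+ #|S :\: C|.-1).
    rewrite -IHm //; apply: eq_bigr => F _; apply: eq_bigr => v vD.
    by rewrite noC // if_same.
  by rewrite -{2}(setIidPr sCS) setID cardsD (setIidPr sCS).
rewrite (eq_bigr _ term) -mulr_sumr; congr (_ * _).
rewrite (eq_bigl [predU R & S]) => [|u]; last by rewrite !inE.
rewrite bigU //= -/a -/b.
rewrite -(sum_proper_subset x a S0) -/b.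
rewrite (bigD1 S) /=; last by rewrite subxx.
rewrite eqxx mulr1 addrC; congr (_ + _).
rewrite [RHS](bigID (fun C => C != set0)) /= addrC.
rewrite [X in _ = X + _]big1 ?add0r; last first.
  by move=> C /andP[_ /negPn/eqP->]; rewrite big_set0 mul0r mulr0.
apply: eq_big => [C | C /andP[_ /negPf->] //].
by rewrite properEneq andbAC (andbC (C != S)).
Qed.

(** * q-binomial coefficients *)

Lemma qnat_neq0 n : qnat n.+1 != 0.
Proof.
apply/eqP => /(congr1 (fun p : {poly rat} => p.[0])) /eqP.
rewrite /qnat horner_sum big_ord_recl !hornerE big1 => [|i _].
  by rewrite addr0 oner_eq0.
by rewrite hornerXn exprS mul0r.
Qed.

Lemma qfact_neq0 n : qfact n != 0.
Proof. by apply/prodf_neq0 => i _; apply: qnat_neq0. Qed.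

Lemma qbinom_over n k : (n < k)%N -> qbinom n k = 0.
Proof. by move=> lt_nk; rewrite /qbinom leqNgt lt_nk. Qed.

Lemma qfact0 : qfact 0 = 1.
Proof. by rewrite /qfact big_ord0. Qed.

Lemma qbinom0 n : qbinom n 0 = 1.
Proof.
apply: (mulIf (qfact_neq0 n)); rewrite mul1r -[RHS](qbinom_fact (leq0n n)).
by rewrite qfact0 mul1r subn0.
Qed.

Lemma qbinomnn n : qbinom n n = 1.
Proof.
apply: (mulIf (qfact_neq0 n)); rewrite mul1r -[RHS](qbinom_fact (leqnn n)).
by rewrite subnn qfact0 mulr1.
Qed.

(** Both sides are q-multinomial: each is [qfact n] over
    [qfact k * qfact (n - k.+1)]. *)
Lemma qbinom_absorb n k :
  (k < n)%N -> qbinom n k.+1 * qnat k.+1 = qbinom n k * qnat (n - k).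
Proof.
move=> ltkn; have e : (n - k = (n - k.+1).+1)%N by rewrite subnSK.
apply: (mulIf (mulf_neq0 (qfact_neq0 k) (qfact_neq0 (n - k.+1)))).
transitivity (qfact n).
  by rewrite -(qbinom_fact ltkn) qfactS -!mulrA; congr (_ * _); rewrite mulrCA.
rewrite -(qbinom_fact (ltnW ltkn)) e qfactS -!mulrA; congr (_ * _).
by rewrite [RHS]mulrC -mulrA.
Qed.

Lemma qbinom_pascal n k :
  (k <= n)%N -> qbinom n.+1 k.+1 = qbinom n k.+1 + 'X^(n - k) * qbinom n k.
Proof.
rewrite leq_eqVlt => /predU1P[-> | ltkn].
  by rewrite !qbinomnn qbinom_over // subnn add0r mulr1.
apply: (mulIf (mulf_neq0 (qfact_neq0 k.+1) (qfact_neq0 (n - k)))).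
rewrite -{1}[(n - k)%N]/(n.+1 - k.+1)%N.
rewrite qbinom_fact; last by lia.
rewrite qfactS.
have -> : n.+1 = (n - k + k.+1)%N by lia.
rewrite qnatD mulrDr mulrDl; congr (_ + _).
  have e : (n - k = (n - k.+1).+1)%N by rewrite subnSK.
  by rewrite -(qbinom_fact ltkn) e (qfactS (n - k.+1)); ring.
by rewrite -(qbinom_fact (ltnW ltkn)) qfactS; ring.
Qed.

(** * Inversions of a subset *)

Section Inversions.

(** The statistic [niblings] as a function of the set of roots. *)
Definition inversions n (R : {set 'I_n}) : nat :=
  (\sum_(v in R) #|[set v' | (v' \notin R) && (v' < v)]|)%N.

Variable n : nat.
Let w : 'I_n -> 'I_n.+1 := widen_ord (leqnSn n).

Lemma inversions_recr (B : {set 'I_n.+1}) :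
  inversions B = (inversions (w @^-1: B) +
                  (ord_max \in B) * (n - #|w @^-1: B|))%N.
Proof.
rewrite /inversions big_mkcond big_ord_recr /= -big_mkcond /=.
have below v : (v <= n)%N ->
    #|[set v' | (v' \notin B) && (v' < v)%N]| =
    #|[set v' | (v' \notin w @^-1: B) && (v' < v)%N]|.
  move=> le_vn; rewrite -!sum1dep_card big_mkcond big_ord_recr /= -big_mkcond.
  rewrite ltnNge le_vn andbF addn0; apply: eq_bigl => i.
  by rewrite !inE.
congr (_ + _)%N.
  apply: eq_big => [v|v _]; first by rewrite inE.
  by apply: below; apply: ltnW.
case: ifP => _; rewrite ?mul0n // mul1n below //.
have -> : [set v' : 'I_n | (v' \notin w @^-1: B) && (v' < n)%N] =
    ~: (w @^-1: B).
  by apply/setP => v; rewrite !inE ltn_ord andbT.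
by rewrite cardsCs setCK card_ord.
Qed.

Let w_inj : injective w.
Proof. by move=> i j /(congr1 val) /= e; apply: val_inj. Qed.

Let w_max i : (w i == ord_max) = false.
Proof. by apply/negbTE; rewrite -val_eqE /= neq_ltn ltn_ord. Qed.

Let max_w (C : {set 'I_n}) : (ord_max \in w @: C) = false.
Proof. by apply/imsetP => -[i _ /eqP]; rewrite eq_sym w_max. Qed.

Let w_setK (C : {set 'I_n}) : w @^-1: (w @: C) = C.
Proof. by apply/setP => i; rewrite inE mem_imset. Qed.

Let w_maxK (C : {set 'I_n}) : w @^-1: (ord_max |: w @: C) = C.
Proof. by apply/setP => i; rewrite !inE w_max mem_imset. Qed.

Lemma sum_set_ordS (A : comNzRingType) (f : {set 'I_n.+1} -> A) :
  \sum_B f B = \sum_(C : {set 'I_n}) (f (w @: C) + f (ord_max |: w @: C)).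
Proof.
rewrite big_split (bigID (fun B : {set 'I_n.+1} => ord_max \in B)) /= addrC.
congr (_ + _).
  rewrite (reindex_onto (fun C : {set 'I_n} => w @: C) (fun B => w @^-1: B)) /=.
    by apply: eq_bigl => C; rewrite max_w w_setK eqxx.
  move=> B /negPf nB; apply/setP => i; case: (unliftP ord_max i) => [j|] ->.
    have -> : lift ord_max j = w j by apply/val_inj/lift_max.
    by rewrite mem_imset // inE.
  by rewrite max_w nB.
rewrite (reindex_onto (fun C : {set 'I_n} => ord_max |: w @: C)
                      (fun B => w @^-1: B)) /=.
  by apply: eq_bigl => C; rewrite setU11 w_maxK eqxx.
move=> B mB; apply/setP => i; case: (unliftP ord_max i) => [j|] ->.
  have -> : lift ord_max j = w j by apply/val_inj/lift_max.
  by rewrite !inE w_max mem_imset // inE.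
by rewrite setU11 mB.
Qed.

(** The last vertex is above all others: outside [B] it makes no inversion, and
    inside [B] it makes one with each non-element. The factor [c] keeps track of
    the two cases. *)
Lemma sum_inversionsS k (c : bool -> {poly rat}) :
  \sum_(B : {set 'I_n.+1} | #|B| == k.+1)
     'X^(inversions B) * c (ord_max \in B) =
  (\sum_(C : {set 'I_n} | #|C| == k.+1) 'X^(inversions C)) * c false +
  'X^(n - k) * (\sum_(C : {set 'I_n} | #|C| == k) 'X^(inversions C)) * c true.
Proof.
rewrite big_mkcond sum_set_ordS big_split /= -!big_mkcond /=.
congr (_ + _).
  rewrite mulr_suml; apply: eq_big => [C | C _]; first by rewrite card_imset.
  by rewrite inversions_recr max_w w_setK mul0n addn0.
rewrite mulr_sumr mulr_suml; apply: eq_big => [C | C].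
  by rewrite cardsU1 max_w card_imset.
rewrite cardsU1 max_w card_imset // eqSS => /eqP <-.
by rewrite inversions_recr setU11 w_maxK mul1n exprD (mulrC 'X^(_ - _)).
Qed.

End Inversions.

Lemma sum_inversions n k :
  \sum_(R : {set 'I_n} | #|R| == k) 'X^(inversions R) = qbinom n k.
Proof.
have sum0 m :
    \sum_(R : {set 'I_m} | #|R| == 0%N) 'X^(inversions R) = qbinom m 0.
  rewrite (big_pred1 set0) => [|R]; last by rewrite cards_eq0.
  by rewrite /inversions big_set0 expr0 qbinom0.
elim: n k => [|n IHn] [|k]; rewrite ?sum0 //.
  rewrite qbinom_over // big1 // => R /eqP cR.
  by have := max_card (mem R); rewrite cR card_ord.
under eq_bigr => R _ do rewrite -['X^_]mulr1.
rewrite (sum_inversionsS n k (fun=> 1)) !mulr1 !IHn.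
have [lekn | ltnk] := leqP k n; first by rewrite qbinom_pascal.
by rewrite !qbinom_over ?mulr0 ?addr0 // ltnW.
Qed.

(** As [enum R] is increasing, [ord_max] comes last in it if at all, and the
    other elements of [R] have the indices 0, 1, 2, and so on. *)
Lemma sum_index n (R : {set 'I_n.+1}) :
  \sum_(r in R | r != ord_max) 'X^(index r (enum R)) =
    qnat (#|R| - (ord_max \in R)).
Proof.
pose R' := R :\ ord_max.
have enumR : enum R = enum R' ++ (if ord_max \in R then [:: ord_max] else [::]).
  have enumE (B : {set 'I_n.+1}) :
      enum B =
        [seq i <- [seq widen_ord (leqnSn n) i | i <- enum 'I_n] | i \in B]
               ++ (if ord_max \in B then [:: ord_max] else [::]).
    rewrite {1}/enum_mem -enumT enum_ordSr filter_rcons.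
    rewrite -[mem B ord_max]/(ord_max \in B).
    by case: ifP => _; rewrite ?cats1 ?cats0.
  rewrite enumE [enum R']enumE !inE eqxx cats0; congr (_ ++ _).
  apply: eq_in_filter => _ /mapP[i _ ->]; rewrite !inE.
  by rewrite -val_eqE /= neq_ltn ltn_ord.
have -> : (#|R| - (ord_max \in R) = #|R'|)%N.
  by rewrite (cardsD1 ord_max R) addKn.
transitivity (\sum_(r <- enum R') ('X^(index r (enum R')) : {poly rat})).
  rewrite big_enum /=.
  apply: eq_big => [r | r]; first by rewrite !inE andbC.
  move=> rR; rewrite enumR index_cat mem_enum ifT // !inE andbC //.
case: (enum R') (enum_uniq R') (cardE R') => [_ ->|r0 t ut ->].
  by rewrite big_nil /qnat big_ord0.
rewrite (big_nth r0) big_mkord; apply: eq_bigr => i _.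
by rewrite index_uniq.
Qed.

(** * Forests in which the last vertex is a leaf *)

Lemma rooted_forests_Vr N (F : parent_map N) R :
  (F \in rooted_forests (~: R) R) = is_forest F && (Vr F == R).
Proof.
apply/rooted_forestsP/andP => -[Facyc H]; split=> //.
  apply/eqP/setP => v; rewrite inE; have := H v.
  by rewrite inE; case: (v \in R) => /= [-> | [u -> _]].
move=> v; rewrite -(eqP H) !inE; case Fv: (F v) => [u|] //=.
by exists u; rewrite ?inE ?orbN.
Qed.

Lemma children_Vr N (F : parent_map N) : children (Vr F) F = root_children F.
Proof.
apply/setP => v; rewrite !inE.
apply/imsetP/existsP => [[u uR Fv]|[u /andP[uR /eqP]]].
  by exists u; rewrite uR /parent_rel Fv eqxx.
by exists u.
Qed.

Section LeafForests.

Variable n : nat.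
Implicit Types (F : parent_map n.+1) (R C : {set 'I_n.+1}).

Definition min_vertex C : 'I_n.+1 :=
  odflt ord0 [pick v in C | [forall w in C, label v <= label w]%N].

Lemma min_vertexP C : C != set0 ->
  [pick v in C | [forall w in C, label v <= label w]%N] = Some (min_vertex C)
  /\ min_vertex C \in C.
Proof.
rewrite /min_vertex => /set0Pn[v0 v0C]; case: pickP => [v /andP[]//|none].
case: (arg_minnP (@label n.+1) v0C) => v vC minv.
have /negbT/negP[] := none v; apply/andP; split=> //.
by apply/forall_inP => w /minv.
Qed.

Lemma vmin_some F : is_forest F -> Vr F != setT ->
  [/\ vmin F = Some (min_vertex (root_children F)),
      min_vertex (root_children F) \in root_children F
    & min_vertex (root_children F) \notin Vr F].
Proof.
move=> Facyc VF; have RF : F \in rooted_forests (~: Vr F) (Vr F).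
  by rewrite rooted_forests_Vr Facyc eqxx.
have := children_neq0 _ RF; rewrite children_Vr => H.
have {H} C0 : root_children F != set0.
  by apply: H; rewrite -setCT (inj_eq (@setC_inj _)).
have [vF vC] := min_vertexP C0; split=> //.
by have := subsetP (children_sub RF) (min_vertex (root_children F));
  rewrite children_Vr in_setC; apply.
Qed.

Lemma VtE F : is_forest F -> Vr F != setT ->
  Vt F = ~: Vr F :\ min_vertex (root_children F).
Proof.
move=> Facyc VF; have [vF _ _] := vmin_some Facyc VF.
by rewrite /Vt /Vs vF setCU setDE.
Qed.

Lemma card_Vt F : is_forest F -> #|Vt F| = (n - #|Vr F|)%N.
Proof.
move=> Facyc; have := cardsC (Vr F); rewrite card_ord => cV.
have [VT | VF] := eqVneq (Vr F) setT.
  by rewrite /Vt VT setTU setCT cards0 cardsT card_ord; lia.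
rewrite VtE //; have [_ _ vR] := vmin_some Facyc VF.
have := cardsD1 (min_vertex (root_children F)) (~: Vr F).
rewrite in_setC vR => cD; apply: (canRL (addKn _)).
by move: cV; rewrite cD addnCA => -[].
Qed.

(** Each vertex of [Vt] contributes the label of its parent minus one, which is
    the parent itself as a number below [n.+1]. *)
Lemma forest_weightE F : is_forest F ->
  forest_weight F = (inversions (Vr F) + scindex F
                     + \sum_(v in Vt F) oapp val 0 (F v))%N.
Proof.
move=> Facyc; rewrite /forest_weight /niblings -/(inversions (Vr F)).
have -> : parents F = (\sum_(v in Vt F) oapp val 0 (F v) + #|Vt F|)%N.
  rewrite /parents -sum1_card -big_split /=; apply: eq_bigr => v.
  by rewrite !inE negb_or /parent_label; case: (F v) => //= u _; rewrite addn1.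
by rewrite addnA addnK.
Qed.

(** In this factor and the next, the value 0 at [ord_max] kills the forests in
    which [ord_max] has a child. *)
Definition parent_weight (u : 'I_n.+1) : {poly rat} :=
  if u == ord_max then 0 else 'X^u.

Definition root_weight R (r : 'I_n.+1) : {poly rat} :=
  if r == ord_max then 0 else 'X^(index r (enum R)).

Definition forest_monomial F : {poly rat} :=
  \prod_(v in ~: Vr F)
    oapp (if v == min_vertex (root_children F) then root_weight (Vr F)
          else parent_weight)
         1 (F v).

Lemma prod_weights F : is_forest F -> Vr F != setT ->
  'X^(inversions (Vr F)) * forest_monomial F =
    if is_leaf F ord_max then 'X^(forest_weight F) else 0.
Proof.
move=> Facyc VF; case: ifPn => [/forallP leafF | ].
  have [vF vC vR] := vmin_some Facyc VF; rewrite /forest_monomial.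
  set vm := min_vertex _ in vF vC vR *.
  have FN v u : F v = Some u -> u == ord_max = false.
    by move=> Fv; apply: contraNF (leafF v) => /eqP e; rewrite /parent_rel Fv e.
  rewrite forest_weightE // !exprD -mulrA; congr (_ * _).
  rewrite (bigD1 vm) /=; last by rewrite in_setC.
  rewrite eqxx; congr (_ * _).
    rewrite /scindex vF; case Fv: (F vm) => [r|] //=.
    by rewrite /root_weight (FN _ _ Fv).
  rewrite expr_sum VtE //; apply: eq_big => v; first by rewrite !inE andbC.
  case/andP=> _ /negPf->; case Fv: (F v) => [u|] //=.
  by rewrite /parent_weight (FN _ _ Fv).
rewrite negb_forall => /existsP[v /negPn/eqP Fv].
rewrite /forest_monomial (bigD1 v) /=; last by rewrite !inE Fv.
rewrite Fv /=; case: (v == _); rewrite /parent_weight /root_weight eqxx.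
  by rewrite mul0r mulr0.
by rewrite mul0r mulr0.
Qed.

Lemma sum_forest_monomial R : R != setT ->
  \sum_(F : parent_map n.+1 | is_forest F && (Vr F == R)) forest_monomial F =
    qnat (#|R| - (ord_max \in R)) * qnat n ^+ (n - #|R|).
Proof.
move=> RT.
have S0 : ~: R != set0 by rewrite -setCT (inj_eq (@setC_inj _)).
have dR : [disjoint R & ~: R] by rewrite -setI_eq0 setICr.
have minP C : C != set0 -> min_vertex C \in C by case/min_vertexP.
have := sum_rooted_forests minP parent_weight (root_weight R) S0 dR.
have -> : (#|~: R|.-1 = n - #|R|)%N by have := cardsC R; rewrite card_ord; lia.
have -> : \sum_(u in R) root_weight R u = qnat (#|R| - (ord_max \in R)).
  rewrite -sum_index big_mkcondr; apply: eq_bigr => u _.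
  by rewrite /root_weight; case: eqP.
have -> : \sum_(u in R :|: ~: R) parent_weight u = qnat n.
  rewrite setUCr (eq_bigl predT) => [|u]; last by rewrite inE.
  rewrite big_ord_recr /= {2}/parent_weight eqxx addr0.
  apply: eq_bigr => i _; rewrite /parent_weight ifF //.
  by apply/negbTE; rewrite -val_eqE /= neq_ltn ltn_ord.
move=> <-; apply: eq_big => [F | F /andP[_ /eqP<-]].
  by rewrite rooted_forests_Vr.
by rewrite children_Vr.
Qed.

Lemma leaf_forestsE k F :
  (F \in leaf_forests n k) =
    [&& is_forest F, #|Vr F| == k.+1 & is_leaf F ord_max].
Proof. by rewrite inE; case: (boolP (is_forest F)) => //= /ncomponentsE ->. Qed.

Lemma leaf_forests_diag : leaf_forests n n = [set [ffun=> None]].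
Proof.
apply/setP => F; rewrite leaf_forestsE in_set1.
apply/and3P/eqP => [[_ /eqP cV _] | ->].
  apply/ffunP => v; rewrite ffunE; apply/eqP.
  have /eqP VT : Vr F == setT by rewrite eqEcard subsetT cardsT card_ord cV /=.
  by have := in_setT v; rewrite -VT inE.
have -> : Vr [ffun=> None] = [set: 'I_n.+1].
  by apply/setP => v; rewrite !inE ffunE.
rewrite cardsT card_ord; split=> //.
  by apply/is_forestP; exists (fun=> 0%N) => v u; rewrite ffunE.
by apply/forallP => v; rewrite /parent_rel ffunE.
Qed.

Lemma forest_weight_None :
  forest_weight ([ffun=> None] : parent_map n.+1) = 0%N.
Proof.
set F : parent_map n.+1 := [ffun=> None].
have VT : Vr F = setT by apply/setP => v; rewrite !inE ffunE.
have Facyc : is_forest F.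
  by apply/is_forestP; exists (fun=> 0%N) => v u; rewrite ffunE.
have -> : forest_weight F = (inversions (Vr F) + scindex F
                     + \sum_(v in Vt F) oapp val 0 (F v))%N.
  exact: forest_weightE.
rewrite big1 => [|v _]; last by rewrite ffunE.
have -> : scindex F = 0%N.
  by rewrite /scindex; case: (vmin F) => // v; rewrite ffunE.
rewrite !addn0 VT; apply: big1 => v _; apply: eq_card0 => w.
by rewrite !inE.
Qed.

Lemma sum_leaf_forests k : (k <= n)%N ->
  \sum_(F in leaf_forests n k) 'X^(forest_weight F) =
    qbinom n k * qnat n ^+ (n - k).
Proof.
rewrite leq_eqVlt => /predU1P[-> | ltkn].
  rewrite leaf_forests_diag big_set1 forest_weight_None qbinomnn subnn !expr0.
  by rewrite mulr1.
rewrite (partition_big (@Vr n.+1) (fun R => #|R| == k.+1)) /=; last first.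
  by move=> F; rewrite leaf_forestsE => /and3P[].
transitivity (\sum_(R : {set 'I_n.+1} | #|R| == k.+1)
   'X^(inversions R) * qnat (k.+1 - (ord_max \in R)) * qnat n ^+ (n - k.+1)).
  apply: eq_bigr => R /eqP cR.
  have RT : R != setT.
    by apply: contraTneq ltkn => RT; move: cR; rewrite RT cardsT card_ord; lia.
  rewrite -mulrA -cR -sum_forest_monomial // mulr_sumr.
  rewrite [RHS](eq_bigr
    (fun F => if is_leaf F ord_max then 'X^(forest_weight F) else 0)).
    rewrite -big_mkcondr /=; apply: eq_bigl => F; rewrite leaf_forestsE.
    by case: (Vr F =P R) => [->|_]; rewrite ?cR ?eqxx /= ?andbT ?andbF.
  move=> F /andP[Facyc /eqP VR]; rewrite -prod_weights ?VR //.
rewrite -mulr_suml (sum_inversionsS n k (fun b : bool => qnat (k.+1 - b))).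
rewrite !sum_inversions.
rewrite subn0 subn1 /= qbinom_absorb //.
have -> : qnat n ^+ (n - k) = qnat n * qnat n ^+ (n - k.+1).
  by rewrite -exprS subnSK.
have qn : qnat n = qnat (n - k) + 'X^(n - k) * qnat k.
  by rewrite -qnatD subnK // ltnW.
by rewrite mulrA [X in _ = _ * X * _]qn; ring.
Qed.

End LeafForests.

Theorem corollary3p4 (n k : nat) (hkn : (k <= n)%N) :
  [/\ qtree n k = \sum_(F in leaf_forests n k) 'X^(forest_weight F),
      \sum_(F in leaf_forests n k) 'X^(forest_weight F)
        = qbinom n k * qnat n ^+ (n - k)
    & forall F : parent_map n.+1, F \in leaf_forests n k ->
        #|Vt F| = if (k < n)%N then (n - k - 1)%N else 0%N].
Proof.
rewrite sum_leaf_forests //; split=> // F; rewrite leaf_forestsE.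
by case/and3P=> Facyc /eqP cV _; rewrite card_Vt // cV; case: ltnP; lia.
Qed.
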